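(* In the setting described in the context (data $\Omega,\mathcal{U},f,\ell,C$), suppose in addition that $\Omega$ is compact. Then for every $x\in\Omega$ there exists $$\bar x\in\operatorname{cl}\Big(\bigcup_{p\in\mathbb{N}}\operatorname{wargmin}_x(\mathcal{MP}_p)\Big)$$ such that $F_{\mathcal{U}}(\bar x)\preceq^u F_{\mathcal{U}}(x)$.
   Context: Conventions: $\mathbb{N}=\{1,2,\dots\}$, $[p]=\{1,\dots,p\}$; inequalities $\le$, $<$ between vectors are componentwise; $e$ is the all-ones vector of appropriate dimension; $\mathbb{R}^m_+$ is the nonnegative orthant; $\operatorname{Int}$, $\operatorname{cl}$, $(\cdot)^c$ are interior, closure, complement in the respective Euclidean space. A cone $C$ (i.e. $\lambda\ge0$, $c\in C$ imply $\lambda c\in C$) is pointed if $C\cap(-C)=\{0\}$ and solid if $\operatorname{Int}C\neq\emptyset$. For nonempty $A,B\subseteq\mathbb{R}^m$, $A\preceq^u B$ means $A\subseteq B-\mathbb{R}^m_+$. Setting: $\Omega\subseteq\mathbb{R}^n$ and $\mathcal{U}\subseteq\mathbb{R}^k$ are nonempty and closed, $\mathcal{U}$ is compact, and $f:\Omega\times\mathcal{U}\to\mathbb{R}^m$ is continuous. $\ell\in\mathbb{R}^m$ is a vector and $C\subseteq(\operatorname{Int}\mathbb{R}^m_+)\cup\{0\}$ is a closed, convex, pointed, solid cone such that $f(\Omega\times\mathcal{U})\subseteq\{\ell\}+\operatorname{Int}C$. For $x\in\Omega$ put $F_{\mathcal{U}}(x):=\{f(x,u)\mid u\in\mathcal{U}\}$,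 $\mathrm{ub}(x):=\big(\sup_{u\in\mathcal{U}}f_1(x,u),\dots,\sup_{u\in\mathcal{U}}f_m(x,u)\big)^\top+e$, $[y^1,y^2]_C:=(\{y^1\}+C)\cap(\{y^2\}-\mathbb{R}^m_+)$, and $F(x):=\operatorname{cl}\big((F_{\mathcal{U}}(x)-\mathbb{R}^m_+)^c\big)\cap[\ell,\mathrm{ub}(x)]_C$. For $p\in\mathbb{N}$, $(\mathcal{MP}_p)$ is the multiobjective problem of minimizing $(y^1,\dots,y^p)\in\mathbb{R}^{mp}$ over all $(x,y^1,\dots,y^p)\in\mathbb{R}^n\times(\mathbb{R}^m)^p$ with $x\in\Omega$, $y^i-\ell\in C$ for all $i\in[p]$, and $\min_{j\in[m]}\{f_j(x,u)-y^i_j\}\le 0$ for all $u\in\mathcal{U}$, $i\in[p]$. A feasible $(\bar x,\bar y^1,\dots,\bar y^p)$ is weakly efficient if there is no feasible $(x,y^1,\dots,y^p)$ with $y^i<\bar y^i$ for all $i\in[p]$; the set of these is $\operatorname{wargmin}(\mathcal{MP}_p)$. Its projection is $\operatorname{wargmin}_x(\mathcal{MP}_p):=\{x'\in\mathbb{R}^n\mid\exists\,y^1,\dots,y^p\in F(x'):(x',y^1,\dots,y^p)\in\operatorname{wargmin}(\mathcal{MP}_p)\}$. *)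

(* Defs.v *)
From mathcomp Require Import all_boot all_order all_algebra.
From mathcomp Require Import all_classical all_reals all_analysis.

Set Implicit Arguments.
Unset Strict Implicit.
Unset Printing Implicit Defensive.

Import Order.TTheory GRing.Theory Num.Theory.
Import numFieldNormedType.Exports.

Local Open Scope classical_set_scope.
Local Open Scope ring_scope.

(* R^d is 'rV[R]_d; its library topology is the product (Euclidean) one.
   Dimensions that must be positive are written as successors. *)

Section Vectors.
Context {R : realType} {d : nat}.
Implicit Types (v w : 'rV[R]_d) (A B C : set 'rV[R]_d).

Definition vle v w : Prop := forall j, v ord0 j <= w ord0 j.

Definition vlt v w : Prop := forall j, v ord0 j < w ord0 j.

Definition orthant : set 'rV[R]_d := [set v | vle 0 v].

Definition set_add A B : set 'rV[R]_d := [set a + b | a in A & b in B].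

Definition set_sub A B : set 'rV[R]_d := [set a - b | a in A & b in B].

Definition upper_le A B : Prop := A `<=` set_sub B orthant.

Definition is_cone C : Prop :=
  forall (lam : R) c, 0 <= lam -> C c -> C (lam *: c).

Definition pointed C : Prop := C `&` [set - c | c in C] = [set 0].

Definition solid C : Prop := C° !=set0.

Definition box C v w : set 'rV[R]_d :=
  set_add [set v] C `&` set_sub [set w] orthant.

End Vectors.

(* The fold starts from the entry of index 0, so it is the minimum of the
   (nonempty) family of entries. *)
Definition vmin {R : realType} {d : nat} (v : 'rV[R]_d.+1) : R :=
  \big[Order.min/v ord0 ord0]_(j < d.+1) v ord0 j.

Section Problem.
Context {R : realType} {n k m : nat}.
Variables (Omega : set 'rV[R]_n.+1) (U : set 'rV[R]_k.+1).
Variable f : 'rV[R]_n.+1 * 'rV[R]_k.+1 -> 'rV[R]_m.+1.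
Variables (ell : 'rV[R]_m.+1) (C : set 'rV[R]_m.+1).

(* f is a total function, but only its values on Omega `*` U are meaningful:
   the definitions below are intended for points x of Omega. *)
Definition FU (x : 'rV[R]_n.+1) : set 'rV[R]_m.+1 := [set f (x, u) | u in U].

Definition ub (x : 'rV[R]_n.+1) : 'rV[R]_m.+1 :=
  (\row_j sup [set f (x, u) ord0 j | u in U]) + const_mx 1.

Definition Fset (x : 'rV[R]_n.+1) : set 'rV[R]_m.+1 :=
  closure (~` set_sub (FU x) orthant) `&` box C ell (ub x).

Definition MP_feasible (p : nat) (x : 'rV[R]_n.+1)
    (y : 'I_p -> 'rV[R]_m.+1) : Prop :=
  [/\ Omega x,
      forall i, C (y i - ell) &
      forall u i, U u -> vmin (f (x, u) - y i) <= 0].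

Definition wargmin (p : nat) (x : 'rV[R]_n.+1)
    (y : 'I_p -> 'rV[R]_m.+1) : Prop :=
  MP_feasible x y /\
  ~ (exists x' (y' : 'I_p -> 'rV[R]_m.+1),
       MP_feasible x' y' /\ forall i, vlt (y' i) (y i)).

Definition wargmin_x (p : nat) : set 'rV[R]_n.+1 :=
  [set x | exists y : 'I_p -> 'rV[R]_m.+1,
     (forall i, Fset x (y i)) /\ wargmin x y].

End Problem.

(* Main.v *)
Require Import Defs.
From mathcomp Require Import all_boot all_order all_algebra.
From mathcomp Require Import all_classical all_reals all_analysis.

Set Implicit Arguments.
Unset Strict Implicit.
Unset Printing Implicit Defensive.

Import Order.TTheory GRing.Theory Num.Theory.
Import numFieldNormedType.Exports.

Local Open Scope classical_set_scope.
Local Open Scope ring_scope.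

(** Write [Y x'] for the set of admissible lower-bound vectors at [x'], that is
    the [y] in [ell + C] such that no scenario value [f (x', u)] exceeds [y]
    strictly in every coordinate ([unexceeded]).  Feasibility of
    [(x', y^1, ..., y^p)] means that every [y^i] is in [Y x'].  Two facts reduce
    the theorem to a compactness argument.

    - [upper_le_unexceeded]: if [Y x] is contained in [Y x'] then
      [F_U(x')] is below [F_U(x)].  Indeed a value [b] of [F_U(x')] outside the
      closed set [F_U(x) - R_+^m] can be lowered a little in all coordinates,
      staying outside that set and inside [ell + C]; the lowered vector is in
      [Y x] but is strictly exceeded by [b], so it is not in [Y x'].

    - [wargmin_below]: for finitely many [y^1, ..., y^p] in [Y x] there is a
      point [x'] of [wargmin_x(MP_p)] such that every [y^i] is in [Y x'].
      Minimize the sum of the first coordinates of the [z^i] over the feasible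
      [(x', z)] with [z^i <= y^i]; these form a nonempty compact set.  A
      feasible point strictly below the minimizer would satisfy the same
      constraint and have a smaller sum, so the minimizer is weakly efficient,
      and [Y x'] is stable under increase within [ell + C].  The minimizer also
      satisfies [z^i <= ub x'], as [Fset] demands: a [z^i] above [ub x'] in one
      coordinate could be shrunk towards [ell] until it meets [ub x'] there
      ([unexceeded_shrink]), which decreases the sum.

    For a finite subset [s] of [Y x], let [B s] be the set of projected weakly
    efficient points [x'] with [s] contained in [Y x'].  It is nonempty by the
    second fact, and these sets generate a filter, which has a cluster point
    [xbar] in the compact set [Omega].  Then [xbar] is in the closure of the
    weakly efficient points.  Each [y] in [Y x] belongs to [Y xbar], because the
    graph of [Y] is closed ([unexceeded_closed]); hence [Y x] is contained in
    [Y xbar] and the first fact applies. *)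

(** * The componentwise order and cones in the positive orthant *)

Section VectorFacts.
Context {R : realType} {d : nat}.
Implicit Types (v w : 'rV[R]_d).

Lemma nbhs_shift_const v (A : set 'rV[R]_d) : nbhs v A ->
  exists2 e : R, 0 < e & A (v - const_mx e) /\ A (v + const_mx e).
Proof.
move=> /nbhs_ballP[r /= r0 rA]; exists (r / 2); first by rewrite divr_gt0.
have r2 : `|r / 2| < r.
  by rewrite gtr0_norm ?divr_gt0// ltr_pdivrMr// ltr_pMr// ltr1n.
split; apply: rA; split => // i j; rewrite !mxE /ball/=.
  by rewrite opprB addrCA subrr addr0.
by rewrite opprD addrA subrr sub0r normrN.
Qed.

Lemma set_sub_orthantP (A : set 'rV[R]_d) w :
  set_sub A orthant w <-> exists2 v, A v & vle w v.
Proof.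
split=> [[v Av [c c0 <-]]|[v Av wv]].
  by exists v => // j; have := c0 j; rewrite !mxE lerBlDr lerDl.
exists v => //; exists (v - w); last by rewrite opprB addrC subrK.
by move=> j; rewrite !mxE subr_ge0.
Qed.

(** A point interior to the orthant stays in it after a small uniform decrease,
    hence has positive coordinates. *)
Lemma cone_sub_orthant_gt0 (C : set 'rV[R]_d) c :
  C `<=` orthant° `|` [set 0] -> C c -> c != 0 -> vlt 0 c.
Proof.
move=> CP /CP[|/= -> /eqP//] /nbhs_shift_const[e e0 [ce _]] _ j.
by rewrite mxE (lt_le_trans e0)//; have := ce j; rewrite !mxE subr_ge0.
Qed.

Lemma cone_sub_orthant_ge0 (C : set 'rV[R]_d) c :
  C `<=` orthant° `|` [set 0] -> C c -> vle 0 c.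
Proof. by move=> CP /CP[/interior_subset|/= -> j]. Qed.

(** [0] cannot be interior to [C], since a small negative multiple of the
    all-ones vector is not in the orthant. *)
Lemma interior_cone_gt0 (C : set 'rV[R]_d) c :
  C `<=` orthant° `|` [set 0] -> C° c -> vlt 0 c.
Proof.
move=> CP /nbhs_shift_const[e e0 [/(cone_sub_orthant_ge0 CP) ce _]] j.
by rewrite mxE (lt_le_trans e0)//; have := ce j; rewrite !mxE subr_ge0.
Qed.

Lemma order_interval_compact v w : compact [set z | vle v z /\ vle z w].
Proof.
rewrite (_ : mkset _ =
    [set z : 'rV[R]_d | forall j, `[v ord0 j, w ord0 j]%classic (z ord0 j)]).
  apply: (@rV_compact _ _ (fun j => `[v ord0 j, w ord0 j]%classic)) => j.
  exact: segment_compact.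
apply/seteqP; split => z /=.
  by move=> [vz zw] j; rewrite in_itv/= vz zw.
by move=> vzw; split => j; have := vzw j; rewrite in_itv/= => /andP[].
Qed.

Lemma vle_closed w : closed [set v | vle v w].
Proof.
rewrite (_ : mkset _ = \bigcap_(j in [set: 'I_d])
    (fun v : 'rV[R]_d => v ord0 j) @^-1` [set t | t <= w ord0 j]).
  apply: closed_bigI => j _; apply: preimage_closed (@closed_le _ _).
  by move=> v _; exact: coord_continuous.
by apply/seteqP; split => v /= vw j; [move=> _; exact: vw|exact: vw].
Qed.

End VectorFacts.

Lemma vmin_le0P (R : realType) (d : nat) (v : 'rV[R]_d.+1) :
  vmin v <= 0 <-> exists j, v ord0 j <= 0.
Proof.
rewrite /vmin; split=> [/bigmin_leP[h|[j _ h]]|[j h]].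
- by exists ord0.
- by exists j.
- by apply/bigmin_leP; right; exists j.
Qed.

Lemma sum_continuous (R : realType) (T : topologicalType) (I : Type)
    (r : seq I) (g : I -> T -> R) :
  (forall i, continuous (g i)) -> continuous (fun t => \sum_(i <- r) g i t).
Proof.
move=> gc t; elim: r => [|i r ih].
  by under eq_fun do rewrite big_nil; exact: cvg_cst.
under eq_fun do rewrite big_cons.
by apply: cvgD => //; exact: gc.
Qed.

(** * Vectors that no scenario exceeds in every coordinate *)

Section RobustValues.
Context {R : realType} {n k m : nat}.
Variables (Omega : set 'rV[R]_n.+1) (U : set 'rV[R]_k.+1).
Variable f : 'rV[R]_n.+1 * 'rV[R]_k.+1 -> 'rV[R]_m.+1.

Implicit Types (x : 'rV[R]_n.+1) (u : 'rV[R]_k.+1) (y : 'rV[R]_m.+1).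

Definition unexceeded (x : 'rV[R]_n.+1) (y : 'rV[R]_m.+1) : Prop :=
  forall u, U u -> exists j, f (x, u) ord0 j <= y ord0 j.

Lemma vmin_unexceeded x y :
  (forall u, U u -> vmin (f (x, u) - y) <= 0) <-> unexceeded x y.
Proof.
have E u j : ((f (x, u) - y) ord0 j <= 0) = (f (x, u) ord0 j <= y ord0 j).
  by rewrite !mxE subr_le0.
split=> h u /h => [/vmin_le0P[j]|[j fy]]; first by rewrite E; exists j.
by apply/vmin_le0P; exists j; rewrite E.
Qed.

Lemma unexceeded_le x y z : vle y z -> unexceeded x y -> unexceeded x z.
Proof. by move=> yz xy u /xy[j fy]; exists j; apply: le_trans fy _. Qed.

Hypothesis f_cont : {within Omega `*` U, continuous f}.

Lemma within_cvg_coord x u j : Omega x -> U u ->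
  f q ord0 j @[q --> within (Omega `*` U) (nbhs (x, u))] --> f (x, u) ord0 j.
Proof.
move=> Ox Uu.
apply: (@cvg_comp _ _ _ f (fun v => v ord0 j) _ (nbhs (f (x, u)))); last first.
  exact: coord_continuous.
by have /subspace_continuousP := f_cont; apply.
Qed.

(** Strict inequalities between a coordinate of [f] and one of [y] are stable
    under small changes of both arguments; since [f] is continuous only on
    [Omega `*` U], the first argument must remain there. *)
Lemma near_coord_gt x u y j : Omega x -> U u -> y ord0 j < f (x, u) ord0 j ->
  \forall q \near (x, u) & y' \near y,
    (Omega `*` U) q -> (y' : 'rV[R]_m.+1) ord0 j < f q ord0 j.
Proof.
move=> Ox Uu /midf_lt[]; set c := (_ / _) => yc cf.
have fc := cvgr_gt _ (within_cvg_coord (j := j) Ox Uu) _ cf.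
have yc' : \forall y' \near y, (y' : 'rV[R]_m.+1) ord0 j < c.
  exact: (cvgr_lt _ (@coord_continuous _ _ _ ord0 j y) _ yc).
exists ([set q | (Omega `*` U) q -> c < f q ord0 j],
  [set y' : 'rV[R]_m.+1 | y' ord0 j < c]).
  by split; [exact: fc|exact: yc'].
move=> -[q y'] [/= qc y'c] /qc.
exact: lt_trans.
Qed.

Lemma near_coord_lt x u y j : Omega x -> U u -> f (x, u) ord0 j < y ord0 j ->
  \forall q \near (x, u) & y' \near y,
    (Omega `*` U) q -> f q ord0 j < (y' : 'rV[R]_m.+1) ord0 j.
Proof.
move=> Ox Uu /midf_lt[]; set c := (_ / _) => fc yc.
have fc' := cvgr_lt _ (within_cvg_coord (j := j) Ox Uu) _ fc.
have yc' : \forall y' \near y, c < (y' : 'rV[R]_m.+1) ord0 j.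
  exact: (cvgr_gt _ (@coord_continuous _ _ _ ord0 j y) _ yc).
exists ([set q | (Omega `*` U) q -> f q ord0 j < c],
  [set y' : 'rV[R]_m.+1 | c < y' ord0 j]).
  by split; [exact: fc'|exact: yc'].
move=> -[q y'] [/= qc y'c] /qc fqc.
exact: lt_trans fqc y'c.
Qed.

(** For a fixed [u], strict excess in every coordinate is an open condition on
    [(x, y)], so each [u] imposes a closed one. *)
Lemma unexceeded_closed : closed Omega ->
  closed [set q | Omega q.1 /\ unexceeded q.1 q.2].
Proof.
move=> Ocl [x y] xy.
have Ox : Omega x.
  apply: Ocl => B Bx; have [|[x' y'] [[/= Ox' _] Bx']] := xy (fst @^-1` B).
    exact: cvg_fst.
  by exists x'.
split=> //= u Uu; apply: contrapT => /forallNP ex.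
have gtj j : y ord0 j < f (x, u) ord0 j by rewrite ltNge; apply/negP/ex.
have := filter_forall _ (fun j => near_coord_gt Ox Uu (gtj j)).
move=> [[A B] [/= [[A1 A2] [/= A1x A2u] A12] By] AB].
have [|[x' y'] [[/= Ox' /(_ u Uu)[j fy]] [/= A1x' By']]] := xy (A1 `*` B).
  by exists (A1, B).
have := AB ((x', u), y') _ j (conj Ox' Uu); rewrite /= ltNge fy.
by move=> /(_ (conj (A12 (x', u) (conj A1x' (nbhs_singleton A2u))) By')).
Qed.

Hypothesis U_compact : compact U.

(** At a point outside [F_U(x) - R_+^m] each scenario fails strictly to reach
    it in some coordinate; by compactness of [U] this persists uniformly in the
    scenario on a neighbourhood. *)
Lemma not_upper_near x y : Omega x -> ~ set_sub (FU U f x) orthant y ->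
  \forall y' \near y, unexceeded x y'.
Proof.
move=> Ox Ny; have cov : near_covering_within U.
  exact/near_covering_withinP/compact_near_coveringP.
apply: (cov 'rV[R]_m.+1 (nbhs y)
  (fun y' u => exists j, f (x, u) ord0 j <= y' ord0 j) _) => u Uu.
have [j fy] : exists j, f (x, u) ord0 j < y ord0 j.
  apply: contrapT => /forallNP Nf; apply: Ny; apply/set_sub_orthantP.
  exists (f (x, u)); first by exists u.
  by move=> j; rewrite leNgt; apply/negP/Nf.
have [[A B] /= [[[A1 A2] [/= A1x A2u] A12] By] AB] := near_coord_lt Ox Uu fy.
exists (A2, B) => //= -[u' y'] [/= A2u' By'] Uu'; exists j; apply/ltW.
by apply: (AB ((x, u'), y')) => //; split => //; apply: A12; split => //;
  exact: nbhs_singleton A1x.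
Qed.

Lemma has_ubound_coord x j : Omega x ->
  has_ubound [set f (x, u) ord0 j | u in U].
Proof.
move=> Ox; have fc : {within U, continuous (fun u => f (x, u) ord0 j)}.
  apply/subspace_continuousP => u Uu B /(within_cvg_coord Ox Uu).
  move=> [[A1 A2] [/= A1x A2u] A12]; apply: filterS A2u => u' A2u' Uu'.
  by apply: (A12 (x, u')) => //; split => //; exact: nbhs_singleton A1x.
have [[u0 Uu0]|U0] := pselect (U !=set0); last first.
  by exists 0 => _ [u Uu <-]; case: U0; exists u.
have [c _ cmax] := compact_EVT_max (ex_intro _ u0 Uu0) U_compact fc.
by exists (f (x, c) ord0 j) => _ [u Uu <-]; apply: cmax; rewrite inE.
Qed.

(** * Feasibility and the bounding box *)

Variables (ell : 'rV[R]_m.+1) (C : set 'rV[R]_m.+1).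
Hypotheses (C_sub : C `<=` orthant° `|` [set 0]) (C_cone : is_cone C).
Hypothesis f_lower : f @` (Omega `*` U) `<=` set_add [set ell] C°.

Lemma f_sub_ell_interior x u : Omega x -> U u -> C° (f (x, u) - ell).
Proof.
move=> Ox Uu; have [|_ -> [c Cc <-]] := f_lower (t := f (x, u)).
  by exists (x, u).
by rewrite addrC addKr.
Qed.

Lemma MP_feasibleE p x (y : 'I_p -> 'rV[R]_m.+1) :
  MP_feasible Omega U f ell C x y <->
  [/\ Omega x, forall i, C (y i - ell) & forall i, unexceeded x (y i)].
Proof.
split=> -[Ox Cy xy]; split=> //.
  by move=> i; apply: (vmin_unexceeded x (y i)).1 => u; exact: xy.
by move=> u i; exact: (vmin_unexceeded x (y i)).2.
Qed.

Hypothesis U_neq0 : U !=set0.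

(** If [y] is unexceeded, raising all its coordinates takes it out of
    [F_U(x) - R_+^m]; so [y] is in the closure of the complement. *)
Lemma unexceeded_Fset x y : Omega x -> C (y - ell) -> unexceeded x y ->
  vle y (ub U f x) -> Fset U f ell C x y.
Proof.
move=> Ox Cy xy yub; split.
  move=> B /nbhs_shift_const[e e0 [_ Be]]; exists (y + const_mx e); split=> //.
  move=> /set_sub_orthantP[_ [u /xy[j fy] <-]] /(_ j).
  by rewrite !mxE leNgt (le_lt_trans fy)// ltrDl.
split; first by exists ell => //; exists (y - ell) => //; rewrite addrC subrK.
by apply/set_sub_orthantP; exists (ub U f x).
Qed.

Lemma coord_lt_ub x u j : Omega x -> U u ->
  f (x, u) ord0 j < ub U f x ord0 j.
Proof.
move=> Ox Uu; rewrite !mxE.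
apply: (@le_lt_trans _ _ (sup [set f (x, u) ord0 j | u in U])).
  by apply: ub_le_sup; [exact: has_ubound_coord|exists u].
by rewrite ltrDl.
Qed.

(** The segment from [y] down to [ell] stays in [ell + C] and decreases in every
    coordinate.  Where its coordinate [j] equals that of [ub x], that coordinate
    alone already bounds all scenario values. *)
Lemma unexceeded_shrink x y j : Omega x -> C (y - ell) ->
  ub U f x ord0 j < y ord0 j ->
  exists y', [/\ C (y' - ell), unexceeded x y' & vlt y' y].
Proof.
move=> Ox Cy uby.
have ell_ub : ell ord0 j < ub U f x ord0 j.
  have [u Uu] := U_neq0; apply: lt_trans (coord_lt_ub j Ox Uu).
  have := interior_cone_gt0 C_sub (f_sub_ell_interior Ox Uu) j.
  by rewrite !mxE subr_gt0.
have ell_y : 0 < y ord0 j - ell ord0 j by rewrite subr_gt0 (lt_trans ell_ub).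
pose s := (ub U f x ord0 j - ell ord0 j) / (y ord0 j - ell ord0 j).
have s0 : 0 <= s by rewrite divr_ge0 ?ltW// subr_gt0.
have s1 : s < 1 by rewrite ltr_pdivrMr// mul1r ltrD2r.
(* [s] is chosen so that coordinate [j] of the new vector is that of [ub x]. *)
exists (ell + s *: (y - ell)); split.
- by rewrite addrC addKr; exact: C_cone.
- move=> u Uu; exists j; rewrite !mxE divfK ?gt_eqF// addrC subrK ltW//.
  by have := coord_lt_ub j Ox Uu; rewrite !mxE.
- have yell : y - ell != 0.
    by apply/eqP => /rowP /(_ j); rewrite !mxE => E; rewrite E ltxx in ell_y.
  move=> i; have := cone_sub_orthant_gt0 C_sub Cy yell i; rewrite !mxE => yi.
  by rewrite -ltrBrDl gtr_pMl.
Qed.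

(** * Weakly efficient points below finitely many vectors *)

Hypotheses (Omega_compact : compact Omega) (C_closed : closed C).
Hypothesis Omega_closed : closed Omega.

(** [prod_topology] carries the product topology for which Tychonoff's theorem
    is stated. *)
Let T (p : nat) := prod_topology (fun _ : 'I_p => 'rV[R]_m.+1).

(** The scalarization by one coordinate of each [z i] suffices: weak efficiency
    only compares points that decrease in every coordinate of every block. *)
Lemma wargmin_below p x (y : 'I_p.+1 -> 'rV[R]_m.+1) : Omega x ->
  (forall i, C (y i - ell)) -> (forall i, unexceeded x (y i)) ->
  exists2 x', wargmin_x Omega U f ell C p.+1 x' &
    Omega x' /\ forall i, unexceeded x' (y i).
Proof.
move=> Ox Cy xy.
pose S := [set q : 'rV[R]_n.+1 * T p.+1 | forall i,
  [/\ Omega q.1, unexceeded q.1 (q.2 i), C (q.2 i - ell) & vle (q.2 i) (y i)]].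
have proj_i i : continuous (fun q : 'rV[R]_n.+1 * T p.+1 => q.2 i).
  move=> q; apply: (@continuous_comp _ _ _ snd (fun z : T p.+1 => z i)).
    exact: cvg_snd.
  exact: (@proj_continuous _ (fun=> 'rV[R]_m.+1) i).
have S_closed : closed S.
  rewrite (_ : S = \bigcap_(i in [set: 'I_p.+1])
    ((fun q : _ * T p.+1 => (q.1, q.2 i)) @^-1`
       [set q | Omega q.1 /\ unexceeded q.1 q.2] `&`
     (fun q : _ * T p.+1 => q.2 i) @^-1`
       ((fun v => v - ell) @^-1` C `&` [set v | vle v (y i)]))); last first.
    apply/seteqP; split => q Sq i; first by move=> _; have [] := Sq i.
    by have [[? ?] [? ?]] := Sq i Logic.I.
  apply: closed_bigI => i _; apply: closedI.
    apply: preimage_closed; last exact: unexceeded_closed.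
    move=> q _; have q1 : p'.1 @[p' --> q] --> q.1 by exact: cvg_fst.
    exact: cvg_pair q1 (proj_i i q).
  apply: preimage_closed; first by move=> q _; exact: proj_i.
  apply: closedI; last exact: vle_closed.
  apply: preimage_closed C_closed => v _.
  exact: (cvgB cvg_id (cvg_cst _)).
have S_compact : compact S.
  apply: (@subclosed_compact _ _
    (Omega `*` [set z : T p.+1 | forall i, vle ell (z i) /\ vle (z i) (y i)])).
  - exact: S_closed.
  - apply: compact_setX => //.
    apply: (@tychonoff _ (fun=> 'rV[R]_m.+1)
      (fun i => [set v | vle ell v /\ vle v (y i)])) => i.
    exact: order_interval_compact.
  move=> q Sq; split; first by have [] := Sq ord0.
  move=> i; have [_ _ Cq qy] := Sq i; split=> // j.
  by have := cone_sub_orthant_ge0 C_sub Cq j; rewrite !mxE subr_ge0.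
have [[x' z] Sxz zmin] : exists2 q, q \in S & forall q', q' \in S ->
    \sum_i q.2 i ord0 ord0 <= \sum_i q'.2 i ord0 ord0.
  apply: compact_EVT_min => //; first by exists (x, y) => i; split.
  apply: continuous_subspaceT; apply: sum_continuous => i q.
  apply: (@continuous_comp _ _ _ (fun q : _ * T p.+1 => q.2 i)
    (fun v : 'rV[R]_m.+1 => v ord0 ord0)).
    exact: proj_i.
  exact: coord_continuous.
have {Sxz}Sz i : [/\ Omega x', unexceeded x' (z i), C (z i - ell) &
  vle (z i) (y i)] by move: Sxz; rewrite inE => /(_ i).
have Ox' : Omega x' by have [] := Sz ord0.
have zy i : vle (z i) (y i) by have [] := Sz i.
have min_le x'' (z' : T p.+1) : Omega x'' ->
    (forall i, unexceeded x'' (z' i)) ->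
    (forall i, C (z' i - ell)) -> (forall i, vle (z' i) (z i)) ->
    \sum_i z i ord0 ord0 <= \sum_i z' i ord0 ord0.
  move=> Ox'' xz' Cz' z'z; apply: (zmin (x'', z')).
  rewrite inE => i; split=> //.
  by move=> j; apply: le_trans (z'z i j) (zy i j).
exists x'; last first.
  by split=> // i; have [_ xz _ _] := Sz i; exact: unexceeded_le (zy i) xz.
exists z; split.
  move=> i; have [_ xz Cz _] := Sz i; apply: unexceeded_Fset => // j.
  rewrite leNgt; apply/negP => /(unexceeded_shrink Ox' Cz)[w [Cw xw wz]].
  (* Replacing the block [z i] alone by [w] contradicts minimality. *)
  pose z' : T p.+1 := fun l => if l == i then w else z l.
  have : \sum_l z' l ord0 ord0 < \sum_l z l ord0 ord0.
    rewrite (bigD1 i)//= [ltRHS](bigD1 i)//= {1}/z' eqxx.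
    apply: ltr_leD => //; apply: ler_sum => l li.
    by rewrite /z' (negbTE li).
  apply/negP; rewrite -leNgt; apply: (min_le x') => // l; rewrite /z'.
  - by case: eqVneq => // _; have [] := Sz l.
  - by case: eqVneq => // _; have [] := Sz l.
  - by case: eqVneq => [->|_] a //; exact/ltW/wz.
split.
  by apply/MP_feasibleE; split=> // i; have [] := Sz i.
move=> [x'' [z' [/MP_feasibleE[Ox'' Cz' xz'] z'z]]].
have : \sum_i z' i ord0 ord0 < \sum_i z i ord0 ord0.
  apply: ltr_sum; last by move=> i _; exact: z'z.
  by apply/hasP; exists ord0; rewrite ?mem_index_enum.
apply/negP; rewrite -leNgt; apply: (min_le x'') => // i j; exact/ltW/z'z.
Qed.

(** Go from [ell] along a direction of [C] until the first coordinate reaches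
    the upper bound of the scenario values. *)
Lemma exists_unexceeded x : Omega x ->
  exists2 y, C (y - ell) & unexceeded x y.
Proof.
move=> Ox; have [u0 Uu0] := U_neq0.
have Cc := f_sub_ell_interior Ox Uu0; set c := f (x, u0) - ell in Cc.
have c0 : 0 < c ord0 ord0.
  by have := interior_cone_gt0 C_sub Cc ord0; rewrite mxE.
pose s := (ub U f x ord0 ord0 - ell ord0 ord0) / c ord0 ord0.
have ell_ub : ell ord0 ord0 < ub U f x ord0 ord0.
  apply: lt_trans (coord_lt_ub ord0 Ox Uu0).
  by move: c0; rewrite !mxE subr_gt0.
exists (ell + s *: c).
  rewrite addrC addKr; apply: C_cone (interior_subset Cc).
  by rewrite divr_ge0 ?subr_ge0// ltW.
move=> u Uu; exists ord0; apply/ltW/(lt_le_trans (coord_lt_ub ord0 Ox Uu)).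
have -> : (ell + s *: c) ord0 ord0 = ell ord0 ord0 + s * c ord0 ord0.
  by rewrite [LHS]mxE [X in _ + X]mxE.
by rewrite divfK ?gt_eqF// addrC subrK.
Qed.

(** A value at [x'] not dominated by [F_U(x)], lowered slightly in every
    coordinate, is unexceeded at [x] but not at [x']. *)
Lemma upper_le_unexceeded x x' : Omega x -> Omega x' ->
  (forall y, C (y - ell) -> unexceeded x y -> unexceeded x' y) ->
  upper_le (FU U f x') (FU U f x).
Proof.
move=> Ox Ox' xx' _ [u Uu <-]; apply: contrapT => /(not_upper_near Ox) xn.
have Cn : \forall y \near f (x', u), C (y - ell).
  apply: (cvgB cvg_id (cvg_cst ell)); exact: f_sub_ell_interior.
have [e e0 [[xe Ce] _]] := nbhs_shift_const (filterI xn Cn).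
have [j] := xx' _ Ce xe u Uu.
by rewrite !mxE leNgt ltrBlDr ltrDl e0.
Qed.

End RobustValues.

(** * The cluster point *)

Theorem theorem4p10 (R : realType) (n k m : nat)
    (Omega : set 'rV[R]_n.+1) (U : set 'rV[R]_k.+1)
    (f : 'rV[R]_n.+1 * 'rV[R]_k.+1 -> 'rV[R]_m.+1)
    (ell : 'rV[R]_m.+1) (C : set 'rV[R]_m.+1)
    (Omega_neq0 : Omega !=set0) (Omega_closed : closed Omega)
    (U_neq0 : U !=set0) (U_closed : closed U) (U_compact : compact U)
    (f_cont : {within Omega `*` U, continuous f})
    (C_sub : C `<=` orthant° `|` [set 0])
    (C_cone : is_cone C) (C_closed : closed C) (C_convex : convex_set C)
    (C_pointed : pointed C) (C_solid : solid C)
    (f_lower : f @` (Omega `*` U) `<=` set_add [set ell] C°)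
    (Omega_compact : compact Omega) :
  forall x, Omega x ->
    exists xbar,
      closure (\bigcup_(p in [set p | (0 < p)%N])
                 wargmin_x Omega U f ell C p) xbar /\
      upper_le (FU U f xbar) (FU U f x).
Proof.
move=> x Ox.
have [y0 Cy0 xy0] :=
  exists_unexceeded f_cont U_compact C_sub C_cone f_lower U_neq0 Ox.
pose W : set 'rV[R]_n.+1 :=
  \bigcup_(p in [set p | (0 < p)%N]) wargmin_x Omega U f ell C p.
pose Y := [set y | C (y - ell) /\ unexceeded U f x y].
pose D := [set s : seq 'rV[R]_m.+1 | forall y, y \in s -> Y y].
pose B (s : seq 'rV[R]_m.+1) : set 'rV[R]_n.+1 :=
  [set x' | [/\ W x', Omega x' & forall y, y \in s -> unexceeded U f x' y]].
have B_filter : Filter (filter_from D B).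
  apply: filter_from_filter; first by exists [::].
  move=> s t Ds Dt; exists (s ++ t).
    by move=> y; rewrite mem_cat => /orP[/Ds|/Dt].
  by move=> x' [Wx' Ox' x'y]; split; split=> // y ys; apply: x'y;
    rewrite mem_cat ys ?orbT.
have B_proper : ProperFilter (filter_from D B).
  apply: filter_from_proper => s Ds.
  (* [y0] is prepended so that the problem index is positive even when [s] is
     empty. *)
  pose y (i : 'I_(size s).+1) := nth y0 (y0 :: s) i.
  have Yy i : Y (y i).
    have : y i \in y0 :: s by exact: mem_nth.
    by rewrite inE => /orP[/eqP->|/Ds].
  have [x' Wx' [Ox' x'y]] := wargmin_below f_cont U_compact C_sub C_cone
    f_lower U_neq0 Omega_compact C_closed Omega_closed Ox
    (fun i => (Yy i).1) (fun i => (Yy i).2).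
  exists x'; split=> //; first by exists (size s).+1.
  move=> z zs; have zi : (index z s < size s)%N by rewrite index_mem.
  have := x'y (Ordinal (zi : (index z s).+1 < (size s).+1)%N).
  by rewrite /y/= nth_index.
have [|xbar [Oxbar cxbar]] := Omega_compact _ B_proper.
  by exists [::] => // x' [].
exists xbar; split.
  move=> A Axbar; have [|x' [[Wx' _ _] Ax']] := cxbar (B [::]) A _ Axbar.
    by exists [::].
  by exists x'.
apply: (upper_le_unexceeded f_cont U_compact f_lower Ox Oxbar) => y Cy xy.
suff cl : closure [set q | Omega q.1 /\ unexceeded U f q.1 q.2] (xbar, y).
  by have [] := unexceeded_closed f_cont Omega_closed cl.
(* Points of [B [:: y]] near [xbar] give points of the closed graph near
   [(xbar, y)]. *)
move=> A [[A1 A2] /= [A1x A2y] A12].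
have [|x' [[_ Ox' x'y] A1x']] := cxbar (B [:: y]) A1 _ A1x.
  by exists [:: y] => // z; rewrite inE => /eqP->.
exists (x', y); split.
  by split=> //=; apply: x'y; rewrite inE.
by apply: A12; split => //=; exact: nbhs_singleton A2y.
Qed.
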